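(* Let $S$ be a finite sequence of variables and let $M,N$ be unlabeled $\lambda$-terms. (1) If $M \Rrightarrow_{S,0} N$, then there exist a labeling $M_\ell$ of $M$ and a labeling $N_\ell$ of $N$ such that $M_\ell \twoheadrightarrow_S N_\ell$. (2) If $M_\ell$ is a labeling of $M$, $N_\ell$ is a labeling of $N$, $M_\ell \twoheadrightarrow_S N_\ell$, and $N_\ell$ is in normal form (there is no $C$ with $N_\ell \to_S C$), then $M \Rrightarrow_{S,0} N$.
   Context: Variables range over a countably infinite set $\mathcal V$; labels over a countably infinite set $\mathcal L$ containing a distinguished label $\star$ that is never bound. Unlabeled terms: $M ::= x \mid M\,M \mid \lambda x.M$. Labeled terms: $A ::= x \mid \lambda^a x.A \mid A\,@^a A$ ($a\in\mathcal L$); in $A\,@^a B$ the label $a$ binds all occurrences of $a$ in $A$. Free labels: $\mathrm{fl}(x)=\emptyset$, $\mathrm{fl}(\lambda^a x.A)=\{a\}\cup\mathrm{fl}(A)$, $\mathrm{fl}(A\,@^a B)=(\mathrm{fl}(A)\setminus\{a\})\cup\mathrm{fl}(B)$. Terms are considered up to renaming of bound variables and bound labels. $A[x:=B]$ is substitution capturing neither variables nor labels; $A[a:=\star]$ replaces every free occurrence of label $a$ by $\star$. The erasure $|A|$ deletes all labels (with $|A\,@^a B| = |A|\,|B|$); $A$ is a labeling of $M$ if $|A|=M$. For a (labeled or unlabeled) one-hole context $C$, $\mathrm{bPath}(C)$ is the sequence of variables bound by abstractions above the hole. $S\oplus T$ is concatenation of variable sequences and $x\cdot S$ prepends $x$.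 A term is away from $S$, written $\uparrow S$, if its free variables are disjoint from the variables in $S$. Labeled reduction relative to $S$: $C[(\lambda^a x.A)\,@^a B] \to_S C[A[a:=\star][x:=B]]$ whenever $(\lambda^a x.A)\,@^a B$ is away from $\mathrm{bPath}(C)\oplus S$; $\twoheadrightarrow_S$ is its reflexive–transitive closure. The superstep judgement $M \Rrightarrow_{S,k} N$ on unlabeled terms ($k\ge 0$ an integer) is inductively defined by: $x\Rrightarrow_{S,0}x$; if $M\Rrightarrow_{x\cdot S,0}M'$ then $\lambda x.M\Rrightarrow_{S,0}\lambda x.M'$; if $M\Rrightarrow_{S,k}M'$ then $\lambda x.M\Rrightarrow_{S,k+1}\lambda x.M'$; if $M\Rrightarrow_{S,0}M'$ and $N\Rrightarrow_{S,0}N'$ then $M\,N\Rrightarrow_{S,0}M'\,N'$; if $M\Rrightarrow_{S,n+1}\lambda x.M'$, $N\Rrightarrow_{S,m}N'$, $(\lambda x.M')\,N'$ is away from $S$, and ($m>0$ implies $M'=\lambda x_1\dots x_n.x$), then $M\,N\Rrightarrow_{S,n+m}M'[x:=N']$. *)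

(* Defs.v *)
From mathcomp Require Import all_boot.
From Stdlib Require Import Relation_Operators.

Set Implicit Arguments.
Unset Strict Implicit.
Unset Printing Implicit Defensive.

(* Terms up to renaming are represented with de Bruijn indices, for variables
   and for labels independently.  The set of variables is nat: the free
   variable number n is the index n + d under d abstractions. *)

Inductive term :=
| Var of nat
| App of term & term
| Lam of term.

(* [None] is the distinguished label, which no application binds.  [Some i] is
   an index: label binders are the function sides of applications, so that
   [Some i] refers to the i-th (from 0, innermost first) application above
   that was entered through its function side, or to a free label if there
   are at most i of them. *)
Definition label := option nat.
Definition star : label := None.

(* [LApp A B] is the labeled application whose label is index 0 in [A]; this
   label is not in scope in [B]. *)
Inductive lterm :=
| LVar of nat
| LLam of label & lterm
| LApp of lterm & lterm.

Fixpoint erase (A : lterm) : term :=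
  match A with
  | LVar x => Var x
  | LLam _ A1 => Lam (erase A1)
  | LApp A1 B1 => App (erase A1) (erase B1)
  end.

Definition labeling (A : lterm) (M : term) : Prop := erase A = M.

Definition up_ren (r : nat -> nat) (x : nat) : nat :=
  if x is y.+1 then (r y).+1 else 0.

Fixpoint ren (r : nat -> nat) (M : term) : term :=
  match M with
  | Var x => Var (r x)
  | App M1 N1 => App (ren r M1) (ren r N1)
  | Lam M1 => Lam (ren (up_ren r) M1)
  end.

Definition up_subst (s : nat -> term) (x : nat) : term :=
  if x is y.+1 then ren succn (s y) else Var 0.

Fixpoint subst (s : nat -> term) (M : term) : term :=
  match M with
  | Var x => s x
  | App M1 N1 => App (subst s M1) (subst s N1)
  | Lam M1 => Lam (subst (up_subst s) M1)
  end.

(* M[x := N], where x is the variable of an abstraction [Lam M] that is being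
   removed. *)
Definition inst (M N : term) : term :=
  subst (fun x => if x is y.+1 then Var y else N) M.

Fixpoint lren (r : nat -> nat) (A : lterm) : lterm :=
  match A with
  | LVar x => LVar (r x)
  | LLam a A1 => LLam a (lren (up_ren r) A1)
  | LApp A1 B1 => LApp (lren r A1) (lren r B1)
  end.

Definition up_relabel (r : nat -> label) (i : nat) : label :=
  if i is j.+1 then omap succn (r j) else Some 0.

Fixpoint relabel (r : nat -> label) (A : lterm) : lterm :=
  match A with
  | LVar x => LVar x
  | LLam a A1 => LLam (obind r a) (relabel r A1)
  | LApp A1 B1 => LApp (relabel (up_relabel r) A1) (relabel r B1)
  end.

Definition up_lsubst (s : nat -> lterm) (x : nat) : lterm :=
  if x is y.+1 then lren succn (s y) else LVar 0.

(* The labels of the substituted terms are shifted when entering the function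
   side of an application, so that they are not captured. *)
Definition shift_labels (s : nat -> lterm) (x : nat) : lterm :=
  relabel (fun i => Some i.+1) (s x).

Fixpoint lsubst (s : nat -> lterm) (A : lterm) : lterm :=
  match A with
  | LVar x => s x
  | LLam a A1 => LLam a (lsubst (up_lsubst s) A1)
  | LApp A1 B1 => LApp (lsubst (shift_labels s) A1) (lsubst s B1)
  end.

(* A[x := B], where x is the variable of a removed abstraction. *)
Definition linst (A B : lterm) : lterm :=
  lsubst (fun x => if x is y.+1 then LVar y else B) A.

(* A[a := star], where a is the label of a removed application. *)
Definition to_star (A : lterm) : lterm :=
  relabel (fun i => if i is j.+1 then Some j else star) A.

Fixpoint fv (M : term) : seq nat :=
  match M with
  | Var x => [:: x]
  | App M1 N1 => fv M1 ++ fv N1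
  | Lam M1 => [seq x.-1 | x <- fv M1 & 0 < x]
  end.

Fixpoint lfv (A : lterm) : seq nat :=
  match A with
  | LVar x => [:: x]
  | LLam _ A1 => [seq x.-1 | x <- lfv A1 & 0 < x]
  | LApp A1 B1 => lfv A1 ++ lfv B1
  end.

Definition away (S : seq nat) (M : term) : Prop :=
  forall x, x \in fv M -> x \notin S.

Definition laway (S : seq nat) (A : lterm) : Prop :=
  forall x, x \in lfv A -> x \notin S.

(* The variables of [S], seen from under d more abstractions. *)
Definition shift_vars (d : nat) (S : seq nat) : seq nat := [seq x + d | x <- S].

Inductive lctx :=
| CHole
| CLam of label & lctx
| CAppL of lctx & lterm
| CAppR of lterm & lctx.

Fixpoint plug (C : lctx) (A : lterm) : lterm :=
  match C with
  | CHole => A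
  | CLam a C1 => LLam a (plug C1 A)
  | CAppL C1 B => LApp (plug C1 A) B
  | CAppR B C1 => LApp B (plug C1 A)
  end.

Fixpoint depth (C : lctx) : nat :=
  match C with
  | CHole => 0
  | CLam _ C1 => (depth C1).+1
  | CAppL C1 _ => depth C1
  | CAppR _ C1 => depth C1
  end.

(* Seen from the hole, the variables bound above it are the first indices,
   the innermost one coming first. *)
Definition bPath (C : lctx) : seq nat := iota 0 (depth C).

Inductive lstep (S : seq nat) : lterm -> lterm -> Prop :=
| LStep C A B :
    laway (bPath C ++ shift_vars (depth C) S) (LApp (LLam (Some 0) A) B) ->
    lstep S (plug C (LApp (LLam (Some 0) A) B))
            (plug C (linst (to_star A) B)).

Definition lsteps (S : seq nat) : lterm -> lterm -> Prop :=
  clos_refl_trans lterm (lstep S).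

Definition lnormal (S : seq nat) (A : lterm) : Prop :=
  ~ exists B, lstep S A B.

(* [SLamS] leaves the bound variable, index 0, out of the sequence.
   In [SBeta], [iter n Lam (Var n)] is the body of \x x1 ... xn. x: its
   variable is the one bound by the abstraction that is being contracted. *)
Inductive superstep : seq nat -> nat -> term -> term -> Prop :=
| SVar S x : superstep S 0 (Var x) (Var x)
| SLam0 S M M' :
    superstep (0 :: shift_vars 1 S) 0 M M' -> superstep S 0 (Lam M) (Lam M')
| SLamS S k M M' :
    superstep (shift_vars 1 S) k M M' -> superstep S k.+1 (Lam M) (Lam M')
| SApp S M M' N N' :
    superstep S 0 M M' -> superstep S 0 N N' ->
    superstep S 0 (App M N) (App M' N')
| SBeta S n m M M' N N' :
    superstep S n.+1 M (Lam M') -> superstep S m N N' ->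
    away S (App (Lam M') N') ->
    (0 < m -> M' = iter n Lam (Var n)) ->
    superstep S (n + m) (App M N) (inst M' N').

(* Main.v *)
Require Import Defs.
From mathcomp Require Import all_boot.
From Stdlib Require Import Relation_Operators FunctionalExtensionality.

(** (1) By induction on the superstep, [M] has a labeling that, applied to [k]
    arguments, reduces to the body of [N] instantiated with them: an
    abstraction counted by [k] is contracted before its body is developed,
    which is sound because a variable outside [S] may be instantiated by any
    term that is away from [S].

    (2) A structurally recursive evaluator performs every contraction that the
    labels allow.  Its results form a monad in which the
    evaluation of [A[x := B]] is the evaluation of [A] bound to that of [B], so
    that it is invariant under labeled reduction, without any appeal to
    termination or confluence.  It fixes normal forms, and its result is
    always a superstep of the erased term. *)

Set Implicit Arguments.
Unset Strict Implicit.
Unset Printing Implicit Defensive.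

Definition scons (T : Type) (a : T) (s : nat -> T) (x : nat) : T :=
  if x is y.+1 then s y else a.

(** * Substitution *)

Lemma up_renE r r' : up_ren r \o up_ren r' = up_ren (r \o r').
Proof. by apply: functional_extensionality => -[|x]. Qed.

Lemma ren_ren r r' M : ren r (ren r' M) = ren (r \o r') M.
Proof.
elim: M r r' => [x|M1 IH1 N1 IH2|M1 IH] r r' //=; first by rewrite IH1 IH2.
by rewrite IH up_renE.
Qed.

Lemma subst_ren s r M : subst s (ren r M) = subst (s \o r) M.
Proof.
elim: M s r => [x|M1 IH1 N1 IH2|M1 IH] s r //=; first by rewrite IH1 IH2.
by rewrite IH; congr (Lam (subst _ _)); apply: functional_extensionality => -[].
Qed.

Lemma ren_subst r s M : ren r (subst s M) = subst (ren r \o s) M.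
Proof.
elim: M s r => [x|M1 IH1 N1 IH2|M1 IH] s r //=; first by rewrite IH1 IH2.
rewrite IH; congr (Lam (subst _ _)); apply: functional_extensionality.
by case=> [|x] //=; rewrite !ren_ren.
Qed.

Lemma subst_subst t s M : subst t (subst s M) = subst (subst t \o s) M.
Proof.
elim: M s t => [x|M1 IH1 N1 IH2|M1 IH] s t //=; first by rewrite IH1 IH2.
rewrite IH; congr (Lam (subst _ _)); apply: functional_extensionality.
by case=> [|x] //=; rewrite subst_ren ren_subst.
Qed.

Lemma up_subst_Var : up_subst Var = Var.
Proof. by apply: functional_extensionality => -[]. Qed.

Lemma subst_Var M : subst Var M = M.
Proof.
by elim: M => [x|M1 IH1 N1 IH2|M1 IH] //=; rewrite ?up_subst_Var ?IH ?IH1 ?IH2.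
Qed.

Lemma lren_lren r r' A : lren r (lren r' A) = lren (r \o r') A.
Proof.
elim: A r r' => [x|a A1 IH|A1 IH1 B1 IH2] r r' //=; last by rewrite IH1 IH2.
by rewrite IH up_renE.
Qed.

Lemma up_relabel_comp r r' :
  obind (up_relabel r) \o up_relabel r' = up_relabel (obind r \o r').
Proof. by apply: functional_extensionality => -[|i] //=; case: (r' i). Qed.

Lemma relabel_relabel r r' A :
  relabel r (relabel r' A) = relabel (obind r \o r') A.
Proof.
elim: A r r' => [x|a A1 IH|A1 IH1 B1 IH2] r r' //=.
- by rewrite IH; case: a.
- by rewrite IH1 IH2 up_relabel_comp.
Qed.

Lemma up_relabel_Some : up_relabel Some = Some.
Proof. by apply: functional_extensionality => -[]. Qed.

Lemma relabel_Some A : relabel Some A = A.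
Proof.
elim: A => [x|a A1 IH|A1 IH1 B1 IH2] //=; first by rewrite IH; case: a.
by rewrite up_relabel_Some IH1 IH2.
Qed.

Lemma relabel_lren l r A : relabel l (lren r A) = lren r (relabel l A).
Proof.
elim: A l r => [x|a A1 IH|A1 IH1 B1 IH2] l r //=; first by rewrite IH.
by rewrite IH1 IH2.
Qed.

Lemma lsubst_lren s r A : lsubst s (lren r A) = lsubst (s \o r) A.
Proof.
elim: A s r => [x|a A1 IH|A1 IH1 B1 IH2] s r //=; last by rewrite IH1 IH2.
by rewrite IH; congr (LLam _ (lsubst _ _)); apply: functional_extensionality => -[].
Qed.

Lemma lren_lsubst r s A : lren r (lsubst s A) = lsubst (lren r \o s) A.
Proof.
elim: A s r => [x|a A1 IH|A1 IH1 B1 IH2] s r //=.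
- rewrite IH; congr (LLam _ (lsubst _ _)); apply: functional_extensionality.
  by case=> [|x] //=; rewrite !lren_lren.
- rewrite IH1 IH2; congr (LApp (lsubst _ _) _); apply: functional_extensionality.
  by move=> x; rewrite /= /shift_labels /= relabel_lren.
Qed.

Lemma relabel_lsubst l s A :
  relabel l (lsubst s A) = lsubst (relabel l \o s) (relabel l A).
Proof.
elim: A l s => [x|a A1 IH|A1 IH1 B1 IH2] l s //=.
- rewrite IH; congr (LLam _ (lsubst _ _)); apply: functional_extensionality.
  by case=> [|x] //=; rewrite relabel_lren.
- rewrite IH1 IH2; congr (LApp (lsubst _ _) _); apply: functional_extensionality.
  move=> x; rewrite /= /shift_labels /= !relabel_relabel.
  by congr (relabel _ _); apply: functional_extensionality => i /=; case: (l i).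
Qed.

Lemma lsubst_lsubst t s A : lsubst t (lsubst s A) = lsubst (lsubst t \o s) A.
Proof.
elim: A s t => [x|a A1 IH|A1 IH1 B1 IH2] s t //=.
- rewrite IH; congr (LLam _ (lsubst _ _)); apply: functional_extensionality.
  by case=> [|x] //=; rewrite lsubst_lren lren_lsubst.
- rewrite IH1 IH2; congr (LApp (lsubst _ _) _); apply: functional_extensionality.
  by move=> x; rewrite /= /shift_labels relabel_lsubst.
Qed.

Lemma up_lsubst_LVar : up_lsubst LVar = LVar.
Proof. by apply: functional_extensionality => -[]. Qed.

Lemma lsubst_LVar A : lsubst LVar A = A.
Proof.
by elim: A => [x|a A1 IH|A1 IH1 B1 IH2] //=; rewrite ?up_lsubst_LVar ?IH ?IH1 ?IH2.
Qed.

Lemma linstE A B : linst A B = lsubst (scons B LVar) A.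
Proof. by []. Qed.

Lemma linst_lsubst s A B :
  lsubst s (linst A B) = linst (lsubst (up_lsubst s) A) (lsubst s B).
Proof.
rewrite !linstE !lsubst_lsubst; congr (lsubst _ A).
apply: functional_extensionality => -[|x] //=.
rewrite lsubst_lren -[LHS]lsubst_LVar; congr (lsubst _ _).
Qed.

Lemma to_star_lsubst s A :
  to_star (lsubst s A) = lsubst (to_star \o s) (to_star A).
Proof. exact: relabel_lsubst. Qed.

Lemma to_star_lren r A : to_star (lren r A) = lren r (to_star A).
Proof. exact: relabel_lren. Qed.

Lemma to_star_shift A : to_star (relabel (fun i => Some i.+1) A) = A.
Proof.
rewrite /to_star relabel_relabel -[RHS]relabel_Some; congr (relabel _ _).
Qed.

Lemma to_star_shift_labels s : to_star \o shift_labels s = s.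
Proof. by apply: functional_extensionality => x; apply: to_star_shift. Qed.

(** A contraction under [s] becomes an extension of the environment by [B]. Index 0 in the terms of
    [s] names the contracted application, hence the [to_star] on them. *)
Lemma linst_to_star_up s A B :
  linst (to_star (lsubst (up_lsubst s) A)) B
  = lsubst (scons B (to_star \o s)) (to_star A).
Proof.
rewrite to_star_lsubst linstE lsubst_lsubst; congr (lsubst _ _).
apply: functional_extensionality => -[|x] //=.
rewrite to_star_lren lsubst_lren -[RHS]lsubst_LVar; congr (lsubst _ _).
Qed.

Lemma erase_lren r A : erase (lren r A) = ren r (erase A).
Proof.
by elim: A r => [x|a A1 IH|A1 IH1 B1 IH2] r //=; rewrite ?IH ?IH1 ?IH2.
Qed.

Lemma erase_relabel l A : erase (relabel l A) = erase A.
Proof.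
by elim: A l => [x|a A1 IH|A1 IH1 B1 IH2] l //=; rewrite ?IH ?IH1 ?IH2.
Qed.

Lemma erase_lsubst s A : erase (lsubst s A) = subst (erase \o s) (erase A).
Proof.
elim: A s => [x|a A1 IH|A1 IH1 B1 IH2] s //=.
- rewrite IH; congr (Lam (subst _ _)); apply: functional_extensionality.
  by case=> [|x] //=; rewrite erase_lren.
- rewrite IH1 IH2; congr (App (subst _ _) _); apply: functional_extensionality.
  by move=> x; rewrite /= erase_relabel.
Qed.

Lemma erase_linst A B : erase (linst A B) = inst (erase A) (erase B).
Proof.
rewrite linstE erase_lsubst; congr (subst _ _).
by apply: functional_extensionality => -[].
Qed.

(** * Free variables *)

Lemma lfvE A : lfv A = fv (erase A).
Proof. by elim: A => [x|a A1 IH|A1 IH1 B1 IH2] //=; rewrite ?IH ?IH1 ?IH2. Qed.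

Lemma mem_fv_Lam M x : (x \in fv (Lam M)) = (x.+1 \in fv M).
Proof.
apply/mapP/idP => [[y]|H]; last by exists x.+1; rewrite // mem_filter.
by rewrite mem_filter => /andP[y_gt0 yM ->]; rewrite prednK.
Qed.

Lemma mem_shift_vars S x : (x.+1 \in shift_vars 1 S) = (x \in S).
Proof.
rewrite /shift_vars; apply/mapP/idP => [[y yS]|H]; last by exists x; rewrite ?addn1.
by rewrite addn1 => -[->].
Qed.

Lemma zero_shift_vars S : 0 \in shift_vars 1 S = false.
Proof. by apply/mapP => -[y _]; rewrite addn1. Qed.

Lemma fv_ren r M y :
  reflect (exists2 x, x \in fv M & y = r x) (y \in fv (ren r M)).
Proof.
apply: (iffP idP).
- elim: M r y => [x|M1 IH1 N1 IH2|M1 IH] r y.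
  + by rewrite inE => /eqP ->; exists x; rewrite ?inE.
  + rewrite /= mem_cat => /orP[/IH1|/IH2] [x xM ->]; exists x => //;
    by rewrite mem_cat xM ?orbT.
  + rewrite /= mem_fv_Lam => /IH [[|x] xM //= [->]].
    by exists x; rewrite ?mem_fv_Lam.
- case=> x xM ->; elim: M r x xM => [z|M1 IH1 N1 IH2|M1 IH] r x.
  + by rewrite !inE => /eqP ->.
  + by rewrite /= !mem_cat => /orP[/IH1|/IH2] ->; rewrite ?orbT.
  + by rewrite /= !mem_fv_Lam => /(IH (up_ren r)).
Qed.

Lemma fv_subst s M y :
  reflect (exists2 x, x \in fv M & y \in fv (s x)) (y \in fv (subst s M)).
Proof.
apply: (iffP idP).
- elim: M s y => [x|M1 IH1 N1 IH2|M1 IH] s y /=.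
  + by exists x; rewrite ?inE.
  + rewrite /= mem_cat => /orP[/IH1|/IH2] [x xM ?]; exists x => //;
    by rewrite mem_cat xM ?orbT.
  + rewrite mem_fv_Lam => /IH [[|x] xM] /=; first by rewrite inE.
    case/fv_ren => z zx [->].
    by exists x; rewrite ?mem_fv_Lam.
- case=> x xM; elim: M s x y xM => [z|M1 IH1 N1 IH2|M1 IH] s x y.
  + by rewrite inE => /eqP ->.
  + by rewrite /= !mem_cat => /orP[/IH1 H|/IH2 H] /H ->; rewrite ?orbT.
  + rewrite /= !mem_fv_Lam => xM yx; apply: (IH _ x.+1) => //=.
    by apply/fv_ren; exists y.
Qed.

Lemma fv_inst M N x :
  x \in fv (inst M N) -> x \in fv (App (Lam M) N).
Proof.
case/fv_subst => -[|y] yM /=; first by rewrite mem_cat => ->; rewrite orbT.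
by rewrite inE => /eqP ->; rewrite mem_cat mem_fv_Lam yM.
Qed.

Definition awayb (S : seq nat) (M : term) : bool :=
  all (fun x => x \notin S) (fv M).

Lemma awayP S M : reflect (away S M) (awayb S M).
Proof. exact: allP. Qed.

Definition lawayb (S : seq nat) (A : lterm) : bool := awayb S (erase A).

Lemma lawayP S A : reflect (laway S A) (lawayb S A).
Proof. by apply: (iffP (awayP _ _)); rewrite /laway lfvE. Qed.

Lemma awayb_App S M N : awayb S (App M N) = awayb S M && awayb S N.
Proof. exact: all_cat. Qed.

Lemma lawayb_LVar S x : lawayb S (LVar x) = (x \notin S).
Proof. exact: andbT. Qed.

Lemma lawayb_LApp S A B : lawayb S (LApp A B) = lawayb S A && lawayb S B.
Proof. exact: awayb_App. Qed.

Lemma awayb_Lam S M : awayb S (Lam M) = awayb (shift_vars 1 S) M.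
Proof.
apply/allP/allP => H x.
- by case: x => [|x]; rewrite ?zero_shift_vars // mem_shift_vars -mem_fv_Lam => /H.
- by rewrite mem_fv_Lam => /H; rewrite mem_shift_vars.
Qed.

Lemma awayb_subst S s M :
  awayb S (subst s M) = all (fun x => awayb S (s x)) (fv M).
Proof.
apply/allP/allP => [H x xM|H y /fv_subst[x xM ys]].
- by apply/allP => y ys; apply: H; apply/fv_subst; exists x.
- exact: (allP (H x xM)).
Qed.

Lemma awayb_ren S S' r M :
  (forall x, (r x \in S') = (x \in S)) -> awayb S' (ren r M) = awayb S M.
Proof.
move=> rS; apply/allP/allP => [H x xM|H y /fv_ren[x xM ->]]; rewrite ?rS.
- by rewrite -rS H //; apply/fv_ren; exists x.
- exact: H.
Qed.

Lemma awayb_ren_succ S M : awayb (0 :: shift_vars 1 S) (ren succn M) = awayb S M.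
Proof. by apply: awayb_ren => x; rewrite inE mem_shift_vars. Qed.

Lemma awayb_ren_shift S M : awayb (shift_vars 1 S) (ren succn M) = awayb S M.
Proof. by apply: awayb_ren => x; rewrite mem_shift_vars. Qed.

Lemma superstep_fv S k M N x :
  superstep S k M N -> x \in fv N -> x \in fv M.
Proof.
move=> H; elim: H x => {S k M N} //=.
- by move=> S M M' _ IH x; rewrite !mem_fv_Lam; apply: IH.
- by move=> S k M M' _ IH x; rewrite !mem_fv_Lam; apply: IH.
- by move=> S M M' N N' _ IH1 _ IH2 x; rewrite !mem_cat => /orP[/IH1|/IH2] ->;
    rewrite ?orbT.
- move=> S n m M M' N N' _ IH1 _ IH2 _ _ x /fv_inst; rewrite !mem_cat.
  by case/orP => [/IH1|/IH2] ->; rewrite ?orbT.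
Qed.

(* A contracted redex is away from [S], so it cannot erase a variable of [S]. *)
Lemma superstep_fv_mem S k M N x :
  superstep S k M N -> x \in S -> x \in fv M -> x \in fv N.
Proof.
move=> H; elim: H x => {S k M N} //=.
- move=> S M M' _ IH x xS; rewrite !mem_fv_Lam; apply: IH.
  by rewrite inE mem_shift_vars.
- move=> S k M M' _ IH x xS; rewrite !mem_fv_Lam; apply: IH.
  by rewrite mem_shift_vars.
- move=> S M M' N N' _ IH1 _ IH2 x xS; rewrite !mem_cat.
  by case/orP => [/(IH1 _ xS)|/(IH2 _ xS)] ->; rewrite ?orbT.
- move=> S n m M M' N N' _ IH1 _ IH2 aw _ x xS xMN; exfalso.
  suff /aw: x \in fv (App (Lam M') N') by rewrite xS.
  move: xMN; rewrite /= !mem_cat.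
  by case/orP => [/(IH1 _ xS)|/(IH2 _ xS)] ->; rewrite ?orbT.
Qed.

(** The side condition of [SBeta] is about results, while the labeled reduction contracts
    abstractions with undeveloped bodies; awayness is therefore carried back to the sources. *)
Lemma superstep_away S k M N : superstep S k M N -> awayb S N -> awayb S M.
Proof.
move=> H /allP aw; apply/allP => x xM; apply/negP => xS.
by move: (aw x (superstep_fv_mem H xS xM)); rewrite xS.
Qed.

(** * Labeled reduction *)

(** Contexts are traded for structural rules: each abstraction adds its variable to the sequence on
    the way down, instead of [bPath] being collected at the hole. *)
Inductive cstep (S : seq nat) : lterm -> lterm -> Prop :=
| CRedex A B : lawayb S (LApp (LLam (Some 0) A) B) ->
    cstep S (LApp (LLam (Some 0) A) B) (linst (to_star A) B)
| CLamC a A A' : cstep (0 :: shift_vars 1 S) A A' ->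
    cstep S (LLam a A) (LLam a A')
| CAppLC A A' B : cstep S A A' -> cstep S (LApp A B) (LApp A' B)
| CAppRC A B B' : cstep S B B' -> cstep S (LApp A B) (LApp A B').

Lemma lawayb_eq_mem S S' A : S =i S' -> lawayb S A = lawayb S' A.
Proof. by move=> E; apply: eq_all => x; rewrite E. Qed.

Lemma shift_vars0 S : shift_vars 0 S = S.
Proof. by rewrite -[RHS]map_id; apply: eq_map => x; rewrite addn0. Qed.

Lemma shift_vars_under d S : shift_vars d (shift_vars 1 S) = shift_vars d.+1 S.
Proof. by rewrite /shift_vars -map_comp; apply: eq_map => x /=; rewrite -addnA. Qed.

Lemma bPath_under d S :
  iota 0 d ++ shift_vars d (0 :: shift_vars 1 S)
  =i iota 0 d.+1 ++ shift_vars d.+1 S.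
Proof.
have -> : iota 0 d.+1 = iota 0 d ++ [:: d] by rewrite -addn1 iotaD.
move=> x; rewrite /= !mem_cat !inE add0n -orbA; congr (_ || _); congr (_ || _).
by rewrite shift_vars_under.
Qed.

Lemma cstepP S A B : cstep S A B <-> lstep S A B.
Proof.
split.
- elim=> {S A B}.
  + move=> S A B aw; apply: (@LStep S CHole); apply/lawayP.
    by rewrite /= shift_vars0.
  + move=> S a _ _ _ [C A B aw]; apply: (@LStep S (CLam a C)); apply/lawayP.
    by rewrite /bPath /= -(lawayb_eq_mem _ (@bPath_under _ _)); apply/lawayP.
  + by move=> S _ _ D _ [C A B aw]; apply: (@LStep S (CAppL C D)).
  + by move=> S D _ _ _ [C A B aw]; apply: (@LStep S (CAppR D C)).
- case=> C {}A {}B; elim: C S => [|a C IH|C IH D|D C IH] S /= aw.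
  + by apply: CRedex; move/lawayP: aw; rewrite /= shift_vars0.
  + apply: CLamC; apply: IH; apply/lawayP.
    by rewrite /bPath (lawayb_eq_mem _ (@bPath_under _ _)); apply/lawayP.
  + exact: CAppLC (IH _ aw).
  + exact: CAppRC (IH _ aw).
Qed.

Lemma lsteps_congr S S' f A B :
  (forall A B, cstep S A B -> cstep S' (f A) (f B)) ->
  lsteps S A B -> lsteps S' (f A) (f B).
Proof.
move=> Hf; elim=> [{}A {}B /cstepP AB|{}A|{}A D {}B _ IH1 _ IH2].
- by apply: rt_step; apply/cstepP; apply: Hf.
- exact: rt_refl.
- exact: rt_trans IH1 IH2.
Qed.

Lemma lsteps_LLam S a A B :
  lsteps (0 :: shift_vars 1 S) A B -> lsteps S (LLam a A) (LLam a B).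
Proof. by apply: lsteps_congr => {A B} A B; apply: CLamC. Qed.

Lemma lsteps_LAppL S A A' B : lsteps S A A' -> lsteps S (LApp A B) (LApp A' B).
Proof. by apply: (@lsteps_congr S S (LApp^~ B)) => {A A'} A A'; apply: CAppLC. Qed.

Lemma lsteps_LAppR S A B B' : lsteps S B B' -> lsteps S (LApp A B) (LApp A B').
Proof. by apply: lsteps_congr => {B B'} B B'; apply: CAppRC. Qed.

Lemma lsteps_redex S A B :
  lawayb S (LApp (LLam (Some 0) A) B) ->
  lsteps S (LApp (LLam (Some 0) A) B) (linst (to_star A) B).
Proof. by move=> aw; apply/rt_step/cstepP/CRedex. Qed.

(** * From supersteps to labeled reductions *)

Fixpoint apps (A : lterm) (Bs : seq lterm) : lterm :=
  if Bs is B :: Bs1 then apps (LApp A B) Bs1 else A.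

(* The result of consuming the outer abstractions of [A] by the arguments;
   only meaningful when [A] has at least [size Bs] of them. *)
Fixpoint lbetas (A : lterm) (Bs : seq lterm) : lterm :=
  match Bs, A with
  | B :: Bs1, LLam _ A1 => lbetas (linst (to_star A1) B) Bs1
  | _, _ => A
  end.

Lemma apps_cat A Bs1 Bs2 : apps A (Bs1 ++ Bs2) = apps (apps A Bs1) Bs2.
Proof. by elim: Bs1 A => //= B Bs1 IH A; apply: IH. Qed.

Lemma lsteps_apps S A A' Bs : lsteps S A A' -> lsteps S (apps A Bs) (apps A' Bs).
Proof. by elim: Bs A A' => //= B Bs IH A A' AA'; apply/IH/lsteps_LAppL. Qed.

(** Serves [SBeta] with positive [m], where the body is a projection. Each consumed argument enters
    the environment at index 0, so the selected index grows by one and the selected term undergoes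
    one more [to_star]. *)
Lemma lbetas_proj n i s A Bs1 Bs2 :
  erase A = iter n Lam (Var (n + i)) -> size Bs1 = n ->
  lbetas (lsubst s A) (Bs1 ++ Bs2) = lbetas (iter n to_star (s i)) Bs2.
Proof.
elim: n i s A Bs1 => [|n IH] i s [x|a A|A1 A2] [|B Bs1] //=; first by case=> ->.
case=> EA [sB]; rewrite linst_to_star_up (IH i.+1) //; first by rewrite -iterSr.
by rewrite erase_relabel EA addSnnS.
Qed.

Lemma iter_to_star_lsubst n s A :
  iter n to_star (lsubst s A) = lsubst (iter n to_star \o s) (iter n to_star A).
Proof. by elim: n => //= n ->; rewrite to_star_lsubst. Qed.

(** An argument returned by a projection outlives n further contractions, each of which stars its
    label 0; shifting it n times beforehand compensates. *)
Definition shift_label (n : nat) (A : lterm) : lterm :=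
  iter n (relabel (fun i => Some i.+1)) A.

Lemma iter_to_star_shift n A : iter n to_star (shift_label n A) = A.
Proof. by elim: n A => //= n IH A; rewrite -iterS iterSr to_star_shift IH. Qed.

Lemma erase_shift_label n A : erase (shift_label n A) = erase A.
Proof. by elim: n => //= n IH; rewrite erase_relabel. Qed.

Lemma lawayb_lsubst S S' s A :
  (forall x, x \notin S -> lawayb S' (s x)) -> awayb S (erase A) ->
  lawayb S' (lsubst s A).
Proof.
move=> sS /allP aw; rewrite /lawayb erase_lsubst awayb_subst.
by apply/allP => x /aw /sS.
Qed.

Lemma lawayb_relabel S l A : lawayb S (relabel l A) = lawayb S A.
Proof. by rewrite /lawayb erase_relabel. Qed.

Lemma lawayb_iter_to_star S n A : lawayb S (iter n to_star A) = lawayb S A.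
Proof. by elim: n => //= n IH; rewrite lawayb_relabel. Qed.

(* An abstraction counted by [k] is contracted before its body is developed,
   hence the development is only described in the presence of [k] arguments. *)
Lemma superstep_lsteps S k M N :
  superstep S k M N -> (0 < k -> awayb S M) ->
  exists A Nl, [/\ erase A = M, erase Nl = N &
    forall S' s Bs, (forall x, x \notin S -> lawayb S' (s x)) ->
      size Bs = k -> all (lawayb S') Bs ->
      lsteps S' (apps (lsubst s A) Bs) (lbetas (lsubst s Nl) Bs)].
Proof.
elim=> {S k M N}.
- move=> S x _; exists (LVar x), (LVar x); split=> // S' s [|//] _ _ _.
  exact: rt_refl.
- move=> S M M' _ [//|A [Nl [EA EN H]]] _.
  exists (LLam star A), (LLam star Nl); split; rewrite /= ?EA ?EN //.
  move=> S' s [|//] sS _ _ /=; apply: lsteps_LLam; apply: (H _ _ [::]) => //.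
  case=> [|x]; rewrite inE //= mem_shift_vars => /sS.
  by rewrite /lawayb erase_lren awayb_ren_succ.
- move=> S k M M' _ IH /(_ isT); rewrite awayb_Lam => aw.
  have [//|A [Nl [EA EN H]]] := IH.
  (* Label 0 ties the abstraction to the first argument; the labels of the body then count from the
     second one. *)
  exists (LLam (Some 0) (relabel (fun i => Some i.+1) A)).
  exists (LLam (Some 0) (relabel (fun i => Some i.+1) Nl)).
  split; rewrite /= ?erase_relabel ?EA ?EN //.
  move=> S' s [//|B Bs] sS [sB] /= /andP[awB awBs].
  rewrite linst_to_star_up to_star_shift.
  (* The bound variable 0 is outside [shift_vars 1 S], so its instance has to be away from [S'],
     which holds for the argument [B]. *)
  have sS1 x : x \notin shift_vars 1 S -> lawayb S' (scons B (to_star \o s) x).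
    by case: x => [|x] //; rewrite mem_shift_vars => /sS /=; rewrite lawayb_relabel.
  apply: rt_trans (H _ _ _ sS1 sB awBs); apply: lsteps_apps.
  have -> : lsubst (scons B (to_star \o s)) A =
      linst (to_star (lsubst (up_lsubst s) (relabel (fun i => Some i.+1) A))) B.
    by rewrite linst_to_star_up to_star_shift.
  apply: lsteps_redex; rewrite lawayb_LApp awB andbT.
  rewrite -/(lsubst s (LLam (Some 0) (relabel (fun i => Some i.+1) A))).
  by apply: lawayb_lsubst sS _; rewrite /= erase_relabel EA awayb_Lam.
- move=> S M M' N N' _ [//|A [A' [EA EA' HA]]] _ [//|B [B' [EB EB' HB]]] _.
  exists (LApp A B), (LApp A' B'); split; rewrite /= ?EA ?EB ?EA' ?EB' //.
  move=> S' s [|//] sS _ _ /=; apply: rt_trans.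
  + apply: lsteps_LAppR; exact: (HB _ _ [::] sS).
  + apply: lsteps_LAppL; apply: (HA _ _ [::]) => // x /sS.
    by rewrite /lawayb /= erase_relabel.
- move=> S n m M M' N N' stM IHM stN IHN /awayP; rewrite awayb_App => /andP[awM' awN'].
  move=> proj _.
  have awM := superstep_away stM awM'; have awN := superstep_away stN awN'.
  have [//|A [A' [EA EA' HA]]] := IHM; have [//|B [B' [EB EB' HB]]] := IHN.
  case: A' EA' HA => // a A' [EA'] HA.
  have shS S' s : (forall x, x \notin S -> lawayb S' (s x)) ->
      forall x, x \notin S -> lawayb S' (shift_labels s x).
    by move=> sS x /sS; rewrite lawayb_relabel.
  have lbeta_inst s D Bs : lbetas (lsubst (shift_labels s) (LLam a A')) (lsubst s D :: Bs)
      = lbetas (lsubst s (linst (to_star A') D)) Bs.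
    rewrite /= linst_to_star_up to_star_shift_labels linst_lsubst.
    congr (lbetas _ Bs); rewrite linstE lsubst_lsubst; congr (lsubst _ _).
    apply: functional_extensionality => -[|x] //=.
    by rewrite lsubst_lren -[LHS]lsubst_LVar.
  case: m stN IHN proj HB => [|m] stN IHN proj HB.
    (* For m = 0 the argument is developed in place, then consumed as the first argument of the
       function side. *)
    rewrite addn0; exists (LApp A B), (linst (to_star A') B').
    split; rewrite /= ?EA ?EB //.
      by rewrite erase_linst erase_relabel EA' EB'.
    move=> S' s Bs sS sB awBs; rewrite -lbeta_inst.
    apply: rt_trans (HA S' (shift_labels s) (lsubst s B' :: Bs) _ _ _); last first.
    + by rewrite /= awBs andbT; apply: lawayb_lsubst sS _; rewrite EB'.
    + by rewrite /= sB.
    + exact: shS.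
    apply: (@lsteps_apps _ _ (LApp _ _)); apply: lsteps_LAppR.
    exact: (HB _ _ [::] sS).
  (* For positive m the argument is consumed undeveloped, together with the first n members of [Bs];
     the projection returns it, and it is then developed in the presence of the others. *)
  exists (LApp A (shift_label n B)), (linst (to_star A') (shift_label n B')).
  split; rewrite /= ?erase_shift_label ?EA ?EB //.
    by rewrite erase_linst erase_relabel erase_shift_label EA' EB'.
  move=> S' s Bs sS sB; rewrite -[Bs](cat_take_drop n) all_cat.
  set Bs1 := take n Bs; set Bs2 := drop n Bs => /andP[aw1 aw2].
  have sz1 : size Bs1 = n by rewrite size_takel // sB leq_addr.
  have sz2 : size Bs2 = m.+1 by rewrite size_drop sB addKn.
  have {proj} EA'n : erase (to_star A') = iter n Lam (Var (n + 0)).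
    by rewrite erase_relabel EA' addn0 proj.
  have lbetas_cat Q Cs :
      lbetas (lsubst s (linst (to_star A') (shift_label n Q))) (Bs1 ++ Cs)
      = lbetas (lsubst (iter n to_star \o s) Q) Cs.
    rewrite linstE lsubst_lsubst (lbetas_proj _ _ EA'n sz1) /=.
    by rewrite iter_to_star_lsubst iter_to_star_shift.
  have {HB} := HB S' (iter n to_star \o s) Bs2 _ sz2 aw2.
  rewrite lbetas_cat => HB; apply: rt_trans (HB _); last first.
    by move=> x /sS; rewrite /= lawayb_iter_to_star.
  rewrite apps_cat; apply: lsteps_apps.
  have := HA S' (shift_labels s) (lsubst s (shift_label n B) :: Bs1).
  rewrite lbeta_inst -[in lbetas _ Bs1](cats0 Bs1) lbetas_cat /=; apply.
  + exact: shS.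
  + by rewrite sz1.
  + by rewrite aw1 andbT; apply: lawayb_lsubst sS _; rewrite erase_shift_label EB.
Qed.

(** * Evaluation of labeled terms *)

(* [Ret x] is a variable that can still consume arguments once instantiated,
   [Done N] a term that cannot, and [Abs v] an abstraction that is contracted
   with an enclosing application. *)
Inductive val := Ret of nat | Done of term | Abs of val.

Fixpoint tm (v : val) : term :=
  match v with
  | Ret x => Var x
  | Done N => N
  | Abs v1 => Lam (tm v1)
  end.

Fixpoint cnt (v : val) : nat := if v is Abs v1 then (cnt v1).+1 else 0.

Fixpoint vren (r : nat -> nat) (v : val) : val :=
  match v with
  | Ret x => Ret (r x)
  | Done N => Done (ren r N)
  | Abs v1 => Abs (vren (up_ren r) v1)
  end.

(* A stack [e] maps each label to the position of its application among the
   contractible enclosing ones, innermost first. *)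
Definition stack := nat -> label.

Definition nostack : stack := fun=> None.

(** The stack inside an abstraction that has consumed the innermost argument: position 0 is lost,
    its label having been starred. *)
Definition pop (e : stack) : stack :=
  fun a => obind (fun i => if i is j.+1 then Some j else None) (e a).

Definition up_env (E : nat -> stack -> val) (x : nat) (e : stack) : val :=
  if x is y.+1 then vren succn (E y e) else Ret 0.

(** The environment receives the stack in force at each leaf. Nothing inside a [Done] term can
    consume an enclosing argument, whence [nostack] there. *)
Fixpoint bind (e : stack) (E : nat -> stack -> val) (v : val) : val :=
  match v with
  | Ret x => E x e
  | Done N => Done (subst (fun x => tm (E x nostack)) N)
  | Abs v1 => Abs (bind (pop e) (up_env E) v1)
  end.

Definition arg_env (B : stack -> val) (x : nat) (e : stack) : val :=
  if x is y.+1 then Ret y else B e.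

(** The awayness test may precede evaluation because labeled reduction preserves its answer. An
    application failing it is never contracted and cuts both its sides off from all enclosing
    applications. A consumed argument is passed as a function of the stack, since its occurrences
    may meet different stacks. *)
Fixpoint ev (S : seq nat) (e : stack) (A : lterm) : val :=
  match A with
  | LVar x => Ret x
  | LLam a A1 =>
    if obind e a == Some 0 then Abs (ev (shift_vars 1 S) (pop e) A1)
    else Done (Lam (tm (ev (0 :: shift_vars 1 S) nostack A1)))
  | LApp A1 B1 =>
    if lawayb S A1 && lawayb S B1 then
      if ev S (up_relabel e) A1 is Abs v
      then bind e (arg_env (fun e1 => ev S e1 B1)) v
      else Done (App (tm (ev S (up_relabel e) A1)) (tm (ev S nostack B1)))
    else Done (App (tm (ev S nostack A1)) (tm (ev S nostack B1)))
  end.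

(** * Monad laws for values *)

Lemma tm_vren r v : tm (vren r v) = ren r (tm v).
Proof. by elim: v r => //= v IH r; rewrite IH. Qed.

Lemma cnt_vren r v : cnt (vren r v) = cnt v.
Proof. by elim: v r => //= v IH r; rewrite IH. Qed.

Lemma vren_vren r r' v : vren r (vren r' v) = vren (r \o r') v.
Proof.
by elim: v r r' => [x|N|v IH] r r' //=; rewrite ?ren_ren // IH up_renE.
Qed.

Lemma eq_bind e E F v : (forall x e', E x e' = F x e') -> bind e E v = bind e F v.
Proof.
move=> EF; suff -> : E = F by [].
by apply: functional_extensionality => x; apply: functional_extensionality.
Qed.

Lemma tm_bind E v :
  tm (bind nostack E v) = subst (fun x => tm (E x nostack)) (tm v).
Proof.
elim: v E => //= v IH E; rewrite IH; congr (Lam (subst _ _)).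
by apply: functional_extensionality => -[|x] //=; rewrite tm_vren.
Qed.

Lemma bind_vren e E r v : bind e E (vren r v) = bind e (fun x => E (r x)) v.
Proof.
elim: v e E r => [x|N|v IH] e E r //=; first by rewrite subst_ren.
by rewrite IH; congr Abs; apply: eq_bind => -[].
Qed.

Lemma vren_bind e E r v :
  vren r (bind e E v) = bind e (fun x e' => vren r (E x e')) v.
Proof.
elim: v e E r => [x|N|v IH] e E r //=.
- rewrite ren_subst; congr (Done (subst _ _)); apply: functional_extensionality.
  by move=> x; rewrite tm_vren.
- by rewrite IH; congr Abs; apply: eq_bind => -[|x] e' //=; rewrite !vren_vren.
Qed.

Lemma bind_Ret e v : bind e (fun x _ => Ret x) v = v.
Proof.
elim: v e => [x|N|v IH] e //=; first by rewrite subst_Var.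
by rewrite -[in RHS](IH (pop e)); congr Abs; apply: eq_bind => -[].
Qed.

Lemma bind_bind e E F v :
  bind e F (bind e E v) = bind e (fun x e' => bind e' F (E x e')) v.
Proof.
elim: v e E F => [x|N|v IH] e E F //=.
- rewrite subst_subst; congr (Done (subst _ _)); apply: functional_extensionality.
  by move=> x; rewrite tm_bind.
- by rewrite IH; congr Abs; apply: eq_bind => -[|x] e' //=; rewrite bind_vren vren_bind.
Qed.

(** * Evaluation under changes of labels and indices *)

Lemma pop_relabel e l : obind (pop e) \o l = pop (obind e \o l).
Proof. by apply: functional_extensionality => a; rewrite /pop /=; case: (l a). Qed.

Lemma nostack_relabel l : obind nostack \o l = nostack.
Proof. by apply: functional_extensionality => a /=; case: (l a). Qed.

(** Popping in the evaluator thus matches [to_star] in the reduct. *)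
Lemma pop_up e : pop (up_relabel e) = obind e \o (fun i => if i is j.+1 then Some j else star).
Proof.
by apply: functional_extensionality => -[|i] //; rewrite /pop /=; case: (e i).
Qed.

Lemma bind_relabel e E l v :
  bind e (fun x e' => E x (obind e' \o l)) v = bind (obind e \o l) E v.
Proof.
elim: v e E => [x|N|v IH] e E //=; first by rewrite nostack_relabel.
rewrite -pop_relabel -IH; congr Abs; apply: eq_bind => -[] //.
Qed.

Lemma ev_relabel S e l A : ev S e (relabel l A) = ev S (obind e \o l) A.
Proof.
elim: A S e l => [x|a A1 IH|A1 IH1 B1 IH2] S e l //=.
- rewrite !IH pop_relabel nostack_relabel; case: a => //= a; by case: (l a).
- rewrite !IH1 !IH2 !nostack_relabel !lawayb_relabel up_relabel_comp.
  case: ifP => // _; case: (ev _ _ A1) => //= v.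
  by rewrite -bind_relabel; apply: eq_bind => -[|x] e' //=; rewrite IH2.
Qed.

Lemma lawayb_lren S S' r A :
  (forall x, (r x \in S') = (x \in S)) -> lawayb S' (lren r A) = lawayb S A.
Proof. by move=> rS; rewrite /lawayb erase_lren (awayb_ren _ rS). Qed.

Lemma ev_lren S S' e r A : (forall x, (r x \in S') = (x \in S)) ->
  ev S' e (lren r A) = vren r (ev S e A).
Proof.
elim: A S S' e r => [x|a A1 IH|A1 IH1 B1 IH2] S S' e r rS //=.
- case: ifP => _ /=.
  + by rewrite (IH (shift_vars 1 S)) // => -[|x] /=;
      rewrite ?zero_shift_vars // !mem_shift_vars.
  + by rewrite (IH (0 :: shift_vars 1 S)) ?tm_vren // => -[|x] /=;
      rewrite !inE //= !mem_shift_vars.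
- rewrite !(lawayb_lren _ rS) !(IH1 S) // !(IH2 S) //.
  case: ifP => _ /=; last by rewrite !tm_vren.
  case: (ev _ _ A1) => [x|N|v] /=; rewrite ?tm_vren //.
  rewrite bind_vren vren_bind; apply: eq_bind => -[|x] e' //=.
  by rewrite (IH2 S).
Qed.

(* [e] has no position [d], so its positions beyond [d] are unreachable. *)
Definition gap (d : nat) (e : stack) : Prop := forall a, e a <> Some d.

Definition trunc (d : nat) (e : stack) : stack :=
  fun a => if e a is Some i then if i < d then Some i else None else None.

Lemma gap_pop d e : gap d.+1 e -> gap d (pop e).
Proof.
move=> g a; move: (g a); rewrite /pop; case: (e a) => // -[|i] //= H [?].
by apply: H; congr (Some _.+1).
Qed.

Lemma gap_up d e : gap d e -> gap d.+1 (up_relabel e).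
Proof.
move=> g [|a] //=; move: (g a); case: (e a) => //= i H [?].
by apply: H; congr Some.
Qed.

Lemma pop_trunc d e : pop (trunc d.+1 e) = trunc d (pop e).
Proof.
apply: functional_extensionality => a; rewrite /pop /trunc.
by case: (e a) => [[|i]|] //=; rewrite ltnS; case: ifP.
Qed.

Lemma up_trunc d e : up_relabel (trunc d e) = trunc d.+1 (up_relabel e).
Proof.
apply: functional_extensionality => -[|a] //=; rewrite /trunc /=.
by case: (e a) => [i|] //=; rewrite ltnS; case: ifP.
Qed.

Lemma trunc0 e : trunc 0 e = nostack.
Proof. by apply: functional_extensionality => a; rewrite /trunc; case: (e a). Qed.

Lemma cnt_bind d e E v : gap d e -> cnt v <= d ->
  (forall x d e, gap d e -> cnt (E x e) <= d) -> cnt (bind e E v) <= d.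
Proof.
elim: v d e E => [x|N|v IH] d e E g //= cv HE; first exact: HE.
case: d g cv => // d g cv; apply: IH => //; first exact: gap_pop.
by case=> [|x] d' e' g' //=; rewrite cnt_vren; apply: HE.
Qed.

(** Nested [Abs] consume positions 0, 1, 2 and so on in turn, so a missing position d stops them
    after d. *)
Lemma cnt_ev d S e A : gap d e -> cnt (ev S e A) <= d.
Proof.
elim: A d S e => [x|a A1 IH|A1 IH1 B1 IH2] d S e g //=.
- case: ifP => // /eqP ea; case: d g => [|d] g /=; last exact: IH (gap_pop g).
  by case: a ea => //= a /(g a).
- case: ifP => // _; have := IH1 _ S _ (gap_up g).
  case: (ev _ _ A1) => //= v cv; apply: cnt_bind => //.
  by case=> [|x] d' e' g' //=; apply: IH2.
Qed.

Lemma bind_trunc d e E v : gap d e -> cnt v <= d ->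
  (forall x d e, gap d e -> E x (trunc d e) = E x e) ->
  bind (trunc d e) E v = bind e E v.
Proof.
elim: v d e E => [x|N|v IH] d e E g //= cv HE; first exact: HE.
case: d g cv => // d g cv; rewrite pop_trunc IH //; first exact: gap_pop.
by case=> [|x] d' e' g' //=; rewrite HE.
Qed.

Lemma ev_trunc d S e A : gap d e -> ev S (trunc d e) A = ev S e A.
Proof.
elim: A d S e => [x|a A1 IH|A1 IH1 B1 IH2] d S e g //=.
- have -> : (obind (trunc d e) a == Some 0) = (obind e a == Some 0).
    case: a => //= a; rewrite /trunc; move: (g a).
    case: (e a) => // -[|i] ga; first by case: d g ga => [|d] g // [].
    by case: ifP.
  case: ifP => // /eqP ea; case: d g => [|d] g; last first.
    by rewrite pop_trunc (IH _ _ _ (gap_pop g)).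
  by case: a ea => //= a /(g a).
- rewrite up_trunc (IH1 _ _ _ (gap_up g)); case: ifP => // _.
  have := cnt_ev S A1 (gap_up g); case: (ev _ _ A1) => //= v cv.
  by apply: bind_trunc => // -[|x] d' e' g' //=; apply: IH2.
Qed.

Lemma ev_gap0 S e A : gap 0 e -> ev S e A = ev S nostack A.
Proof. by move=> g; rewrite -(ev_trunc _ _ g) trunc0. Qed.

Lemma cnt_ev_nostack S A : cnt (ev S nostack A) = 0.
Proof. by apply/eqP; rewrite -leqn0; apply: cnt_ev. Qed.

(** * Invariance under labeled reduction *)

Lemma lawayb_subst_eq S S' s A :
  (forall x, lawayb S' (s x) = (x \notin S)) -> lawayb S' (lsubst s A) = lawayb S A.
Proof.
move=> sS; rewrite /lawayb erase_lsubst awayb_subst.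
by apply: eq_all => x; apply: sS.
Qed.

(** The law from which invariance follows. Its hypothesis is an equality of booleans, as the
    awayness tests must give the same answer before and after the substitution. *)
Lemma ev_lsubst S S' s e A : (forall x, lawayb S' (s x) = (x \notin S)) ->
  ev S' e (lsubst s A) = bind e (fun x e' => ev S' e' (s x)) (ev S e A).
Proof.
elim: A S S' s e => [x|a A1 IH|A1 IH1 B1 IH2] S S' s e sS //=.
- have lr P := @ev_lren S' P _ succn.
  case: ifP => _ /=.
  + rewrite (IH (shift_vars 1 S)).
      congr Abs; apply: eq_bind => -[|x] e' //=.
      by apply: ev_lren => x'; rewrite mem_shift_vars.
    case=> [|x]; first by rewrite /= lawayb_LVar !zero_shift_vars.
    by rewrite mem_shift_vars -sS /lawayb /= erase_lren awayb_ren_shift.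
  + rewrite (IH (0 :: shift_vars 1 S)).
      rewrite tm_bind; congr (Done (Lam (subst _ _))); apply: functional_extensionality.
      case=> [|x] //=; rewrite (@ev_lren S') ?tm_vren // => x'.
      by rewrite inE mem_shift_vars.
    case=> [|x]; first by rewrite /= lawayb_LVar.
    by rewrite inE /= mem_shift_vars -sS /lawayb /= erase_lren awayb_ren_succ.
- have shS x : lawayb S' (shift_labels s x) = (x \notin S).
    by rewrite -sS lawayb_relabel.
  rewrite (lawayb_subst_eq _ shS) (lawayb_subst_eq _ sS).
  rewrite !(IH1 S) // !(IH2 S) // !tm_bind.
  have bshift e' v : bind e' (fun x e'' => ev S' e'' (shift_labels s x)) v
      = bind (obind e' \o (fun i => Some i.+1)) (fun x e'' => ev S' e'' (s x)) v.
    by rewrite -bind_relabel; apply: eq_bind => x e''; rewrite ev_relabel.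
  have sub_shift : (fun x => tm (ev S' nostack (shift_labels s x)))
      = (fun x => tm (ev S' nostack (s x))).
    by apply: functional_extensionality => x; rewrite ev_relabel nostack_relabel.
  rewrite sub_shift; case: ifP => // _; rewrite bshift.
  case: (ev _ _ A1) => [x|N|v] //=.
  (* The labels of the instance are shifted, so none of them names the application just entered;
     without position 0 the instance cannot become an [Abs]. *)
  + have g : gap 0 (obind (up_relabel e) \o (fun i => Some i.+1)).
      by move=> i /=; case: (e i).
    rewrite (ev_gap0 _ _ g); have := cnt_ev_nostack S' (s x).
    by case: (ev _ _ (s x)).
  + have -> : pop (obind (up_relabel e) \o (fun i => Some i.+1)) = e.
      by apply: functional_extensionality => i; rewrite /pop /=; case: (e i).
    rewrite !bind_bind; apply: eq_bind => -[|x] e' //=; first by rewrite (IH2 S).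
    by rewrite bind_vren bind_Ret.
Qed.

(** A contracted redex is away from [S] and contraction creates no free variable, so a variable of
    [S] occurs in neither the redex nor its reduct. *)
Lemma cstep_fv S A B x : cstep S A B -> x \in S -> (x \in lfv A) = (x \in lfv B).
Proof.
move=> AB; rewrite !lfvE; elim: AB x => {S A B} /=.
- move=> S A B /allP aw x xS.
  have xN : x \notin fv (erase (LApp (LLam (Some 0) A) B)).
    by apply/negP => /aw; rewrite xS.
  rewrite -[LHS]/(x \in fv (erase (LApp (LLam (Some 0) A) B))) (negbTE xN).
  apply/esym/negbTE; apply: contra xN; rewrite erase_linst => /fv_inst.
  by rewrite erase_relabel.
- move=> S a A A' _ IH x xS; rewrite [LHS]mem_fv_Lam [RHS]mem_fv_Lam.
  by apply: IH; rewrite inE mem_shift_vars.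
- by move=> S A A' B _ IH x /IH; rewrite !mem_cat => ->.
- by move=> S A B B' _ IH x /IH; rewrite !mem_cat => ->.
Qed.

Lemma cstep_lawayb S A B : cstep S A B -> lawayb S A = lawayb S B.
Proof.
move=> AB; apply/allP/allP => H x xM; apply/negP => xS.
- by move: (H x); rewrite -lfvE (cstep_fv AB xS) lfvE xM xS => /(_ isT).
- by move: (H x); rewrite -lfvE -(cstep_fv AB xS) lfvE xM xS => /(_ isT).
Qed.

(** Needed because the [Abs] branch of [ev] leaves the bound variable out of the sequence, whereas
    [CLamC] puts it in. *)
Lemma cstep_sub S S' A B : {subset S' <= S} -> cstep S A B -> cstep S' A B.
Proof.
move=> sub AB; elim: AB S' sub => {S A B}.
- move=> S A B /allP aw S' sub; apply: CRedex; apply/allP => x /aw.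
  by apply: contra; apply: sub.
- move=> S a A A' _ IH S' sub; apply: CLamC; apply: IH => -[|x].
  + by rewrite !inE.
  + by rewrite !inE !mem_shift_vars; apply: sub.
- by move=> S A A' B _ IH S' sub; apply/CAppLC/IH.
- by move=> S A B B' _ IH S' sub; apply/CAppRC/IH.
Qed.

Lemma ev_cstep S e A B : cstep S A B -> ev S e A = ev S e B.
Proof.
move=> AB; have sub : {subset S <= S} by [].
elim: AB {-2}S sub e => {S A B}.
- move=> S A B aw S' sub e.
  have := cstep_sub sub (CRedex aw) => AB.
  move/allP: aw => aw; have {}aw : lawayb S' (LApp (LLam (Some 0) A) B).
    by apply/allP => x /aw; apply: contra; apply: sub.
  have awA := aw; move: awA; rewrite lawayb_LApp => /andP[awA awB].
  (* This is the sequence with which the [Abs] branch evaluates the body; it may omit the bound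
     variable because the instance [B] is away from [S']. *)
  rewrite linstE (@ev_lsubst (shift_vars 1 S')).
    rewrite /= awA awB /= ev_relabel -pop_up.
    by apply: eq_bind => -[].
  case=> [|x]; rewrite /= ?zero_shift_vars ?awB //.
  by rewrite mem_shift_vars lawayb_LVar.
- move=> S a A A' _ IH S' sub e /=.
  rewrite !IH // => -[|x]; rewrite !inE ?zero_shift_vars ?mem_shift_vars //; exact: sub.
- move=> S A A' B AA' IH S' sub e /=.
  by rewrite (cstep_lawayb (cstep_sub sub AA')) !IH.
- move=> S A B B' BB' IH S' sub e /=.
  rewrite (cstep_lawayb (cstep_sub sub BB')) !IH //.
  case: ifP => // _; case: (ev _ _ A) => //= v.
  by apply: eq_bind => -[|x] e' //=; rewrite IH.
Qed.

(** The last hypothesis rules out an outermost [Abs]. On the function side of an application that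
    passes the test it holds because an abstraction labeled 0 there would form a redex. *)
Lemma ev_normal S e A : lnormal S A ->
  (forall a A1, A = LLam a A1 -> obind e a <> Some 0) ->
  cnt (ev S e A) = 0 /\ tm (ev S e A) = erase A.
Proof.
elim: A S e => [x|a A1 IH|A1 IH1 B1 IH2] S e nA he //=.
- rewrite (introF eqP (he _ _ erefl)) /=; split=> //.
  have [||_ ->] // := IH (0 :: shift_vars 1 S) nostack; last by case.
  by case=> B AB; apply: nA; exists (LLam a B); apply/cstepP/CLamC/cstepP.
- have nA1 : lnormal S A1.
    by case=> B AB; apply: nA; exists (LApp B B1); apply/cstepP/CAppLC/cstepP.
  have nB1 : lnormal S B1.
    by case=> B AB; apply: nA; exists (LApp A1 B); apply/cstepP/CAppRC/cstepP.
  have [|_ ->] := IH2 S nostack nB1; first by case.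
  case: ifP => aw; last by have [|_ ->] := IH1 S nostack nA1; first by case.
  have [|] := IH1 S (up_relabel e) nA1.
    case=> [[|a]|] // A2 EA1; last by rewrite /=; case: (e a).
    move=> _; apply: nA; exists (linst (to_star A2) B1); subst A1.
    by apply/cstepP/CRedex; rewrite lawayb_LApp.
  by case: (ev _ _ A1) => //= [x|N] _ ->.
Qed.

(** * From evaluation to supersteps *)

(* Only the head variable of an evaluated body can continue with the arguments
   that its instance consumes. *)
Lemma bind_arg_env e E i v :
  (forall x, x != i -> forall e' e'', cnt (E x e') = 0 /\ E x e' = E x e'') ->
  cnt (E i nostack) = 0 ->
  exists e', [/\ tm (bind e E v) = subst (fun x => tm (E x e')) (tm v),
    cnt (bind e E v) = cnt v + cnt (E i e') &
    0 < cnt (E i e') -> tm v = iter (cnt v) Lam (Var (cnt v + i))].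
Proof.
elim: v e E i => [x|N|v IH] e E i HE Ei /=.
(* The witness is the stack at the head leaf if that leaf is [i], and [nostack] otherwise: the other
   variables have instances independent of the stack, and [Done] uses [nostack] throughout. *)
- case: (eqVneq x i) => [->|xi]; first by exists e; rewrite !add0n.
  have [c0 Ee] := HE x xi e nostack.
  by exists nostack; rewrite c0 Ei -Ee.
- by exists nostack; rewrite Ei.
- have [|| e' [Et Ec Ep]] := IH (pop e) (up_env E) i.+1.
  + case=> [|x] //; rewrite eqSS => xi e' e'' /=.
    by have [c0 Ee] := HE x xi e' e''; rewrite cnt_vren c0 Ee.
  + by rewrite /= cnt_vren.
  move: Ec Ep; rewrite /= cnt_vren => Ec Ep; exists e'; split.
  + rewrite Et; congr (Lam (subst _ _)); apply: functional_extensionality.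
    by case=> [|x] //=; rewrite tm_vren.
  + by rewrite Ec addSn.
  + by move=> /Ep {1}->; rewrite addSnnS.
Qed.

Lemma ev_superstep S e A : superstep S (cnt (ev S e A)) (erase A) (tm (ev S e A)).
Proof.
elim: A S e => [x|a A1 IH|A1 IH1 B1 IH2] S e /=.
- exact: SVar.
- case: ifP => _ /=; first exact: SLamS.
  by have := IH (0 :: shift_vars 1 S) nostack; rewrite cnt_ev_nostack; apply: SLam0.
- have sB : superstep S 0 (erase B1) (tm (ev S nostack B1)).
    by have := IH2 S nostack; rewrite cnt_ev_nostack.
  case: ifP => [/andP[awA awB]|_] /=; last first.
    by have := IH1 S nostack; rewrite cnt_ev_nostack => sA; apply: SApp.
  have := IH1 S (up_relabel e); case: (ev _ _ A1) => [x|N|v] /= sA;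
    [exact: SApp | exact: SApp |].
  (* One stack [e'] serves all occurrences of the argument, so a single superstep of it, of index
     [cnt (ev S e' B1)], is enough. *)
  have [||e' [-> -> proj]] :=
    @bind_arg_env e (arg_env (fun e1 => ev S e1 B1)) 0 v.
  + by case.
  + exact: cnt_ev_nostack.
  have -> : (fun x => tm (arg_env (fun e1 => ev S e1 B1) x e'))
      = scons (tm (ev S e' B1)) Var.
    by apply: functional_extensionality => -[].
  apply: (SBeta sA (IH2 S e')); last by move=> /proj; rewrite addn0.
  (* The test was made on the sources; supersteps create no free variable, so it passes to the
     results. *)
  move=> x; rewrite /= mem_cat => /orP[/(superstep_fv sA)|/(superstep_fv (IH2 S e'))].
  + exact: (allP awA).
  + exact: (allP awB).
Qed.

Theorem mainTheorem1 (S : seq nat) (M N : term) :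
  (superstep S 0 M N ->
     exists Ml Nl : lterm,
       [/\ labeling Ml M, labeling Nl N & lsteps S Ml Nl]) /\
  (forall Ml Nl : lterm,
     labeling Ml M -> labeling Nl N -> lsteps S Ml Nl -> lnormal S Nl ->
     superstep S 0 M N).
Proof.
split=> [/superstep_lsteps [] // A [Nl [EA EN H]]|A Nl <- <- steps nNl].
- exists A, Nl; split=> //.
  rewrite -[A]lsubst_LVar -[Nl]lsubst_LVar; apply: (H S LVar [::]) => // x.
  by rewrite lawayb_LVar.
- have Eev : ev S nostack A = ev S nostack Nl.
    elim: steps {nNl} => [B C /cstepP|//|B C D _ -> _ ->] //; exact: ev_cstep.
  have [|_ <-] := @ev_normal S nostack Nl nNl; first by case.
  by rewrite -Eev; have := ev_superstep S nostack A; rewrite cnt_ev_nostack.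
Qed.
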